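(* Let $D$ be a connected locally semicomplete digraph on $n\ge 3$ vertices that is not strong, and let $C_1,C_2,\dots,C_\ell$ be the acyclic ordering of the strong components of $D$. If $U(D)$ is 2-connected, then there exist a shortest $(C_1,C_\ell)$-path $P$ and a Hamilton oriented cycle $R$ in $D$ such that $P$ is a subpath of $R$ and the set of backward arcs of $R$ is exactly $A(P)$. Such a Hamilton oriented cycle $R$ can be constructed in time polynomial in the size of $D$.
   Context: For $x\in V(D)$, $N^+(x)=\{y: xy\in A(D)\}$, $N^-(x)=\{y: yx\in A(D)\}$. A semicomplete digraph is obtained from a complete graph by replacing each edge by one or both of its orientations. $D$ is locally semicomplete if $D[N^+(x)]$ and $D[N^-(x)]$ are semicomplete for every $x$. $U(D)$ is the underlying undirected graph; $D$ is connected if $U(D)$ is connected and strong if there is a directed path between every ordered pair of vertices. An acyclic ordering $C_1,\dots,C_\ell$ of the strong components (maximal strong subdigraphs) is one with no arc from $C_j$ to $C_i$ for $i<j$. For vertex-disjoint subgraphs $S,T$, an $(S,T)$-path is a directed path $p_1\dots p_t$ with $p_1\in V(S)$, $p_t\in V(T)$ and all other vertices outside $S\cup T$. An oriented cycle $R=v_1\dots v_mv_1$ in $D$ is a cyclic sequence of distinct vertices with consecutive ones adjacent in $D$; it is Hamilton if it contains all vertices. The arc between $v_i$ and $v_{i+1}$ (indices mod $m$) is forward if $v_iv_{i+1}\in A(D)$ and backward otherwise. *)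

(* Defs.v *)
From mathcomp Require Import all_boot.

Set Implicit Arguments.
Unset Strict Implicit.
Unset Printing Implicit Defensive.

(* A digraph on the finite vertex set T is a relation D : rel T, where D x y
   means that xy is an arc; the absence of loops is the separate hypothesis
   [irreflexive D].  Arcs are handled as ordered pairs in T * T. *)

Section Digraphs.
Variable T : finType.
Implicit Types (D e : rel T) (X Y S : {set T}) (P Q R : seq T).

Definition out_nbhd D (x : T) : {set T} := [set y | D x y].
Definition in_nbhd D (x : T) : {set T} := [set y | D y x].

Definition semicomplete_on D X : Prop :=
  {in X &, forall x y, x != y -> D x y || D y x}.

Definition locally_semicomplete D : Prop :=
  forall x, semicomplete_on D (out_nbhd D x) /\ semicomplete_on D (in_nbhd D x).

Definition underlying D : rel T := [rel x y | D x y || D y x].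

Definition strong D : Prop := forall x y, connect D x y.

Definition induced e X : rel T := [rel x y | [&& x \in X, y \in X & e x y]].

Definition reachable_within e X : bool :=
  [forall x in X, forall y in X, connect (induced e X) x y].

(* For a symmetric relation e, reachability is the usual connectivity. *)
Definition connected e : Prop := reachable_within e [set: T].

(* Maximal strong subdigraphs are induced, so they are given by their vertex
   sets.  The empty set is never maximal when T is inhabited. *)
Definition strong_component D X : bool := maxset (reachable_within D) X.

Definition acyclic_ordering D (C : seq {set T}) : Prop :=
  [/\ uniq C,
      forall X, (X \in C) = strong_component D X
    & forall i j x y, i < j < size C ->
        x \in nth set0 C j -> y \in nth set0 C i -> ~~ D x y].

Definition k_connected (k : nat) e : Prop :=
  k < #|T| /\ forall X, #|X| < k -> reachable_within e (~: X).

(* A directed path is the non-empty sequence of its (distinct) vertices. *)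
Definition st_path D S S' P : Prop :=
  if P is x :: Q then
    [/\ path D x Q, uniq P, x \in S, last x Q \in S'
      & forall z, z \in P -> z != x -> z != last x Q -> z \notin S :|: S']
  else False.

Definition shortest_st_path D S S' P : Prop :=
  st_path D S S' P /\ forall Q, st_path D S S' Q -> size P <= size Q.

Definition path_arcs P : seq (T * T) := zip P (behead P).

Definition oriented_cycle D R : Prop :=
  2 < size R /\ ucycle (underlying D) R.

Definition hamilton_oriented_cycle D R : Prop :=
  oriented_cycle D R /\ forall x, x \in R.

(* The pairs (v_i, v_(i+1)), indices modulo the length. *)
Definition cyclic_pairs R : seq (T * T) := zip R (rot 1 R).

Definition backward_arcs D R : seq (T * T) :=
  [seq (u.2, u.1) | u <- cyclic_pairs R & ~~ D u.1 u.2].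

(* The cycle may traverse the subpath in either direction. *)
Definition subpath_of_cycle P R : Prop :=
  exists i, prefix P (rot i R) \/ prefix P (rot i (rev R)).

Definition digraph_size D : nat := #|T| + #|[set u : T * T | D u.1 u.2]|.

End Digraphs.

(* Model of computation: programs of a first-order, call-by-value functional
   language over binary trees (in the style of N. D. Jones' languages WHILE
   and F), the running time being the number of evaluation steps.  Trees are
   immutable and hence can be shared, so that for a fixed program each step is
   a constant number of pointer operations; polynomial time in this model is
   therefore polynomial time on Turing machines. *)

Inductive tree := Leaf | Node of tree & tree.

Definition hd t := if t is Node a _ then a else Leaf.
Definition tl t := if t is Node _ b then b else Leaf.

Inductive expr :=
  | EVar of nat
  | ENil
  | ECons of expr & expr
  | EHd of expr
  | ETl of expr
  | EIf of expr & expr & expr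
  | ELet of expr & expr
  | ECall of nat & seq expr.

(* The list of the function bodies; [ECall f es] calls the f-th one. *)
Definition program := seq expr.

(* [eval p env e v n]: with the variables bound to env (de Bruijn indices), e
   evaluates to v in n steps.  A called body only sees its arguments. *)
Inductive eval (p : program) : seq tree -> expr -> tree -> nat -> Prop :=
  | EvVar env i :
      eval p env (EVar i) (nth Leaf env i) 1
  | EvNil env :
      eval p env ENil Leaf 1
  | EvCons env e1 e2 v1 v2 n1 n2 :
      eval p env e1 v1 n1 -> eval p env e2 v2 n2 ->
      eval p env (ECons e1 e2) (Node v1 v2) (n1 + n2).+1
  | EvHd env e v n :
      eval p env e v n -> eval p env (EHd e) (hd v) n.+1
  | EvTl env e v n :
      eval p env e v n -> eval p env (ETl e) (tl v) n.+1
  | EvIfCons env e e1 e2 a b v n m :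
      eval p env e (Node a b) n -> eval p env e1 v m ->
      eval p env (EIf e e1 e2) v (n + m).+1
  | EvIfNil env e e1 e2 v n m :
      eval p env e Leaf n -> eval p env e2 v m ->
      eval p env (EIf e e1 e2) v (n + m).+1
  | EvLet env e1 e2 v1 v n m :
      eval p env e1 v1 n -> eval p (v1 :: env) e2 v m ->
      eval p env (ELet e1 e2) v (n + m).+1
  | EvCall env f es body vs v n m :
      onth p f = Some body ->
      evals p env es vs n -> eval p vs body v m ->
      eval p env (ECall f es) v (n + m).+1
with evals (p : program) : seq tree -> seq expr -> seq tree -> nat -> Prop :=
  | EvsNil env :
      evals p env [::] [::] 0
  | EvsCons env e es v vs n m :
      eval p env e v n -> evals p env es vs m ->
      evals p env (e :: es) (v :: vs) (n + m).

(* On the given input, the function 0 of p returns output in at most t steps. *)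
Definition computes_within (p : program) (input output : tree) (t : nat) : Prop :=
  exists2 n, n <= t & eval p [:: input] (ECall 0 [:: EVar 0]) output n.

Definition enc_seq (ts : seq tree) : tree := foldr Node Leaf ts.
Definition enc_bool (b : bool) : tree := if b then Node Leaf Leaf else Leaf.
(* Unary notation, of size linear in n; only used for n < #|T|. *)
Definition enc_nat (n : nat) : tree := enc_seq (nseq n Leaf).

(* The adjacency matrix, row by row, the vertices being listed as enum T. *)
Definition enc_digraph (T : finType) (D : rel T) : tree :=
  enc_seq [seq enc_seq [seq enc_bool (D x y) | y <- enum T] | x <- enum T].

(* A vertex is output as its row number in that matrix. *)
Definition enc_vertices (T : finType) (R : seq T) : tree :=
  enc_seq [seq enc_nat (index x (enum T)) | x <- R].

(* Main.v *)
(* Inserting a vertex w before its first out-neighbour on a path keeps it a path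
   as soon as w is adjacent to some vertex of the path; this yields a Hamilton
   path h = v_1 ... v_n of D, along which the strong components are consecutive
   intervals.  The greedy path P starts at v_1 and always jumps to the last
   out-neighbour along h, until it reaches v_n; it is a shortest
   (C_1, C_l)-path.  Every interior vertex q of P is the last vertex of its
   component, and 2-connectivity forces an arc from the predecessor of q on h to
   its successor.  Hence no two consecutive vertices of h are interior vertices
   of P, and deleting the interior of P from h leaves a path from v_1 to v_n,
   which the reversal of P closes to the cycle R. *)

Require Import Defs.
From mathcomp Require Import all_boot zify.

Set Implicit Arguments.
Unset Strict Implicit.
Unset Printing Implicit Defensive.

(** * Insertion, absorption and the greedy walk on vertex sequences *)

Section Algorithm.
Variables (T : finType) (D : rel T).
Implicit Types (x y z p q v w : T) (s rem fuel acc : seq T).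

Fixpoint insert w s :=
  if s is v :: s' then if D w v then w :: s else v :: insert w s' else [:: w].

Fixpoint absorb rem s : seq T * seq T :=
  if rem is w :: rem' then
    if has (underlying D w) s then absorb rem' (insert w s)
    else let r := absorb rem' s in (w :: r.1, r.2)
  else ([::], s).

(** Only the length of [fuel] matters: it bounds the number of passes. *)
Fixpoint absorb_iter fuel rem s :=
  if fuel is _ :: fuel' then
    let r := absorb rem s in absorb_iter fuel' r.1 r.2
  else s.

(* [p] is the last vertex of the greedy path found so far, [acc] holds its
   interior in reverse order, and [s] is what remains of the Hamilton path; the
   greedy path moves to [x] when [p] has no out-neighbour after [x].  [kept]
   and [hops] separate the two parts of the result. *)
Fixpoint walk p s acc :=
  if s is x :: s' then
    if has (D p) s' then x :: walk p s' acc
    else if nilp s' then x :: acc else walk x s' (x :: acc)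
  else acc.

Fixpoint kept p s :=
  if s is x :: s' then
    if has (D p) s' then x :: kept p s'
    else if nilp s' then [:: x] else kept x s'
  else [::].

Fixpoint hops p s :=
  if s is x :: s' then
    if has (D p) s' then hops p s'
    else if nilp s' then [::] else x :: hops x s'
  else [::].

(** With [acc] empty, the output is the cycle without its start: first the vertices outside the
    greedy interior, up to the end of [s], then that interior read backwards. *)
Lemma walkE p s acc : walk p s acc = kept p s ++ catrev (hops p s) acc.
Proof.
elim: s p acc => [//|x s IHs] p acc /=.
case: ifP => _ /=; first by rewrite IHs.
by case: ifP => _ //=; rewrite IHs.
Qed.

Lemma perm_kept_hops p s : perm_eq (kept p s ++ hops p s) s.
Proof.
elim: s p => [//|x s IHs] p /=.
case: ifP => _ /=; first by rewrite perm_cons.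
case: (s) IHs => [//|z s1] IHs /=.
rewrite (perm_catCA _ [:: x] (hops x (z :: s1))) perm_cons; exact: IHs.
Qed.

Lemma size_walk p s : size (walk p s [::]) = size s.
Proof. by rewrite walkE -(perm_size (perm_kept_hops p s)) !size_cat size_rev. Qed.

Lemma last_kept p s x : last x (kept p s) = last x s.
Proof.
elim: s p x => [//|y s IHs] p x /=; case: ifP => _ /=; first exact: IHs.
by case: (s) IHs => [//|z s1] IHs; rewrite [nilp _]/= IHs.
Qed.

Lemma perm_insert w s : perm_eq (insert w s) (w :: s).
Proof.
elim: s => [//|v s IHs] /=; case: ifP => // _.
by rewrite perm_sym (perm_catCA [:: w] [:: v] s) /= perm_cons perm_sym.
Qed.

Lemma size_insert w s : size (insert w s) = (size s).+1.
Proof. by rewrite (perm_size (perm_insert w s)). Qed.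

Lemma perm_absorb rem s :
  perm_eq ((absorb rem s).1 ++ (absorb rem s).2) (rem ++ s).
Proof.
elim: rem s => [//|w rem IHrem] s /=; case: ifP => _ /=.
  apply: (perm_trans (IHrem _)).
  by rewrite perm_sym (perm_catCA [:: w] rem s) perm_cat2l perm_sym perm_insert.
by rewrite perm_cons IHrem.
Qed.

Lemma size_absorb rem s :
  size (absorb rem s).1 + size (absorb rem s).2 = size rem + size s.
Proof. by rewrite -!size_cat (perm_size (perm_absorb rem s)). Qed.

Lemma size_absorb1 rem s : size (absorb rem s).1 <= size rem.
Proof.
elim: rem s => [//|w rem IHrem] s /=.
by case: ifP => _ /=; [apply: leqW|rewrite ltnS].
Qed.

(** Until the first insertion the path is unchanged, so the first vertex of [rem] with a neighbour
    on [s] does get inserted. *)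
Lemma ltn_size_absorb1 rem s :
  has (fun w => has (underlying D w) s) rem -> size (absorb rem s).1 < size rem.
Proof.
elim: rem s => [//|w rem IHrem] s /=.
by case: ifP => _ /= => [_|/IHrem]; rewrite ltnS ?size_absorb1.
Qed.

End Algorithm.

(** * Moving arcs and inserting vertices in locally semicomplete digraphs *)

Lemma connect_exit (T : finType) (r : rel T) (A : pred T) a b :
  connect r a b -> A a -> ~~ A b -> exists x y, [/\ r x y, A x & ~~ A y].
Proof.
case/connectP => p + ->; elim: p a => [|c p IHp] a /=; first by move=> _ ->.
move=> /andP[rac rcp] Aa Ab; case: (boolP (A c)) => Ac; first exact: IHp rcp Ac Ab.
by exists a, c.
Qed.

Lemma locally_semicomplete_converse (T : finType) (D : rel T) :
  locally_semicomplete D -> locally_semicomplete (fun x y => D y x).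
Proof.
move=> Dls x; have [Do Di] := Dls x.
by split=> y z Dy Dz /(fun ne => (Do y z, Di y z, ne))[[Ho Hi] ne];
  rewrite orbC; [apply: Hi|apply: Ho] => //; rewrite inE in Dy Dz *.
Qed.

Section LocallySemicomplete.
Variables (T : finType) (D : rel T).
Hypothesis Dls : locally_semicomplete D.

Lemma out_adj x y z : D x y -> D x z -> y != z -> D y z || D z y.
Proof. by move=> Dxy Dxz; apply: (Dls x).1; rewrite inE. Qed.

Lemma in_adj x y z : D y x -> D z x -> y != z -> D y z || D z y.
Proof. by move=> Dxy Dxz; apply: (Dls x).2; rewrite inE. Qed.

(** The tail slides along a path from [x] to [y]: the next vertex and [z] are both out-neighbours of
    the current tail, hence adjacent, and an arc from [z] to that vertex would let [z] reach [y]. *)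
Lemma arc_shift_tail x y z :
  D x z -> connect D x y -> ~~ connect D z y -> D y z.
Proof.
move=> + /connectP[p + ->]; elim: p x => [//|u p IHp] x /= Dxz /andP[Dxu Dp] zNy.
have cuy: connect D u (last u p) by apply/connectP; exists p.
apply: (IHp u) => //; have /orP[//|Dzu] : D u z || D z u.
  by apply: out_adj Dxu Dxz _; apply: contraNneq zNy => <-.
by case/negP: zNy; apply: connect_trans (connect1 Dzu) cuy.
Qed.

(** While [w] is adjacent to no passed vertex, it cannot dominate the next one, since two
    in-neighbours of a vertex are adjacent. Once a passed vertex dominates [w], so does each
    following vertex ([after]), by adjacency of out-neighbours, up to the first one that [w]
    dominates. *)
Lemma path_insert v w s :
  path D v s -> w \notin v :: s -> ~~ D w v -> has (underlying D w) (v :: s) ->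
  path D v (insert D w s).
Proof.
have after u s' : D u w -> path D u s' -> w \notin s' -> path D u (insert D w s').
  elim: s' u => [|x s' IHs] u /= Duw; first by rewrite Duw.
  case/andP=> Dux Ds; rewrite inE negb_or => /andP[wx ws].
  case: ifP => /= Dwx; first by rewrite Duw Dwx.
  rewrite Dux IHs //.
  by have := out_adj Duw Dux wx; rewrite Dwx.
elim: s v => [|u s IHs] v Dvs; rewrite in_cons negb_or => /andP[wv ws] wNv.
  by rewrite /underlying /= (negPf wNv) orbF andbT.
case: (boolP (D v w)) => [Dvw _|vNw]; first exact: after.
rewrite /underlying /= (negPf wNv) (negPf vNw) /= => adj.
move: Dvs => /= /andP[Dvu Dus]; case: ifPn => /= Dwu.
  by have := in_adj Dwu Dvu wv; rewrite (negPf wNv) (negPf vNw).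
by rewrite Dvu IHs.
Qed.

Lemma sorted_insert w s :
  sorted D s -> w \notin s -> has (underlying D w) s -> sorted D (insert D w s).
Proof.
case: s => [//|v s] Ds ws adj; rewrite [insert _ _ _]/=.
by case: ifPn => Dwv; [rewrite /= Dwv|apply: path_insert].
Qed.

Lemma sorted_absorb rem s :
  sorted D s -> uniq (rem ++ s) -> sorted D (absorb D rem s).2.
Proof.
elim: rem s => [//|w rem IHrem] s Ds /= /andP[]; rewrite mem_cat negb_or.
move=> /andP[wr ws] urs; case: ifP => [adj|_]; last exact: IHrem.
apply: IHrem; first exact: sorted_insert.
rewrite cat_uniq (perm_uniq (perm_insert D w s)) /= ws.
rewrite (eq_has_r (perm_mem (perm_insert D w s))) /= negb_or wr.
by move: urs; rewrite cat_uniq.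
Qed.

(** While [rem] is non-empty, connectivity gives an adjacent pair between [rem] and [s], so every
    pass shortens [rem] and [size rem] passes suffice. *)
Lemma absorb_iter_spec fuel rem s :
  connected (underlying D) -> sorted D s -> s != [::] -> uniq (rem ++ s) ->
  (forall x, x \in rem ++ s) -> size rem <= size fuel ->
  sorted D (absorb_iter D fuel rem s) /\ perm_eq (absorb_iter D fuel rem s) (rem ++ s).
Proof.
move=> Dc; elim: fuel rem s => [|f fuel IHf] rem s Ds s0 urs Trs /=.
  by rewrite leqn0 size_eq0 => /eqP->.
move=> le_rem; have pa := perm_absorb D rem s.
have [||||so pe] := IHf (absorb D rem s).1 (absorb D rem s).2 (sorted_absorb Ds urs).
- rewrite -size_eq0 -lt0n -(ltn_add2l (size (absorb D rem s).1)) addn0.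
  rewrite size_absorb (leq_ltn_trans (size_absorb1 D rem s)) //.
  by rewrite -[X in X < _]addn0 ltn_add2l lt0n size_eq0.
- by rewrite (perm_uniq pa).
- by move=> x; rewrite (perm_mem pa).
- case: rem => [//|w rem] in le_rem Trs urs pa *.
  rewrite -ltnS; apply: leq_trans _ le_rem; apply: ltn_size_absorb1.
  case: s s0 => [//|y s] _ in Ds urs Trs pa *.
  have := Dc; rewrite /connected /reachable_within => /forall_inP/(_ w (in_setT _)).
  move=> /forall_inP/(_ y (in_setT _)) /(@connect_exit _ _ (mem (w :: rem))).
  have yNr : y \notin w :: rem.
    by move: urs; rewrite uniq_catC cat_cons cons_uniq mem_cat negb_or => /andP[/andP[]].
  case=> [|//|a [b [/and3P[_ _ Uab] ar]]]; first exact: mem_head.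
  move=> bNr; have {}bNr : b \notin w :: rem by [].
  apply/hasP; exists a => //; apply/hasP; exists b => //.
  by have := Trs b; rewrite mem_cat (negPf bNr).
- by split=> //; apply: perm_trans pe pa.
Qed.

End LocallySemicomplete.

(** This is [arc_shift_tail] in the converse digraph. *)
Lemma arc_shift_head (T : finType) (D : rel T) x y z : locally_semicomplete D ->
  D x z -> connect D y z -> ~~ connect D y x -> D x y.
Proof.
have cr u v : connect D u v = connect (fun x y => D y x) v u.
  by rewrite (connect_rev D).
move=> Dls Dxz; rewrite !cr => cyz xNy.
exact: (arc_shift_tail (locally_semicomplete_converse Dls) (x := z) (z := x)).
Qed.

(** * The greedy path along a Hamilton path, and the vertices it leaves *)

Section HamiltonPath.
Variables (T : finType) (D : rel T) (h : seq T).
Hypothesis Dls : locally_semicomplete D.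
Hypothesis Dcut : k_connected 2 (underlying D).
Hypotheses (Dh : sorted D h) (uh : uniq h) (Th : forall x, x \in h).
Implicit Types (x y z p q : T) (a b s : seq T).

Lemma suffix_path a x b : h = a ++ x :: b -> path D x b.
Proof. by move=> eh; move: Dh; rewrite eh => /cat_sorted2[]. Qed.

Lemma connect_suffix a x b y : h = a ++ x :: b -> y \in x :: b -> connect D x y.
Proof. by move=> /suffix_path/path_connect; apply. Qed.

Lemma connect_prefix a x b y :
  h = a ++ x :: b -> y \in rcons a x -> connect D y x.
Proof.
rewrite mem_rcons inE => eh /predU1P[->|ya] //; case/splitPr: ya eh => a1 a2 eh.
apply: (connect_suffix (a := a1) (b := a2 ++ x :: b)); first by rewrite eh -catA.
by rewrite inE mem_cat mem_head !orbT.
Qed.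

(** The path leaves the set of vertices that reach [p], and [arc_shift_tail] moves the tail of the
    leaving arc to [p]. *)
Lemma has_out_arc p x s :
  path D x s -> connect D x p -> ~~ connect D (last x s) p -> has (D p) s.
Proof.
elim: s x => [|z s IHs] x /=; first by move=> _ ->.
move=> /andP[Dxz Dzs] cxp lNp; case: (boolP (connect D z p)) => czp.
  by rewrite (IHs z) ?orbT.
by rewrite (arc_shift_tail Dls Dxz).
Qed.

(* If q is alone in its strong component, then 2-connectivity yields an arc that
   jumps over q, which the shift lemmas move to yz; otherwise y and q lie in the
   same component. *)
Lemma bypass a y q z b :
  h = a ++ [:: y, q, z & b] -> ~~ connect D z q -> D y z.
Proof.
move=> eh zNq; have eq : h = rcons a y ++ [:: q, z & b] by rewrite cat_rcons.
have ez : h = rcons (rcons a y) q ++ z :: b by rewrite !cat_rcons.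
have /= /and3P[Dyq Dqz _] := suffix_path eh.
case: (boolP (connect D q y)) => [cqy|qNy].
  apply: (arc_shift_tail Dls Dqz cqy); apply: contraNN zNq => czy.
  exact: connect_trans czy (connect1 Dyq).
have := uh; rewrite eq cat_uniq => /and3P[_ hNay /= /andP[qNzb _]].
have zq : z != q by apply: contraNneq zNq => ->.
have qNay : q \notin rcons a y by apply: contra hNay => qay; rewrite /= qay.
have zNay : z \notin rcons a y.
  by apply: contra hNay => zay; rewrite /= zay orbT.
have yq : y != q by apply: contraNneq qNay => <-; rewrite mem_rcons mem_head.
have := (Dcut.2 [set q]); rewrite cards1 => /(_ isT)/forall_inP/(_ y).
rewrite !inE => /(_ yq)/forall_inP/(_ z); rewrite !inE => /(_ zq).
case/(@connect_exit _ _ (mem (rcons a y))) => //.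
  by rewrite inE mem_rcons mem_head.
move=> u [v [/and3P[uq vq /orP Duv] uay vNay]].
have cuy := connect_prefix eh uay.
have vzb : v \in z :: b.
  have {}vNay : v \notin rcons a y by [].
  have := Th v; rewrite eq mem_cat (negPf vNay) in_cons.
  by move: vq; rewrite !inE => /negPf->.
have czv := connect_suffix ez vzb.
have {}Duv : D u v.
  case: Duv => // Dvu; case/negP: zNq; apply: (connect_trans czv).
  exact: connect_trans (connect1 Dvu) (connect_trans cuy (connect1 Dyq)).
have Dyv : D y v.
  apply: (arc_shift_tail Dls Duv cuy); apply: contraNN zNq => cvy.
  exact: connect_trans czv (connect_trans cvy (connect1 Dyq)).
apply: (arc_shift_head Dls Dyv czv); apply: contraNN zNq => czy.
exact: connect_trans czy (connect1 Dyq).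
Qed.

(** Contrapositive of [has_out_arc]; it shows that a greedy jump never stays in the component of
    [p]. *)
Lemma jump_strict p x s :
  path D x s -> ~~ has (D p) s -> ~~ connect D (last x s) p -> ~~ connect D x p.
Proof. by move=> Dxs pNs lNp; apply: contra pNs => cxp; apply: has_out_arc cxp lNp. Qed.

(** If [z] reached [x], [arc_shift_head] would give an arc from [p] to [z], against the greedy
    choice of [x]. So [x] ends its component and [bypass] gives the arc from [y] to [z]; as [p] has
    no such arc, [y] is not [p]. *)
Lemma jump_next a y p x z b : h = a ++ [:: y, x, z & b] -> D p x ->
    ~~ has (D p) (z :: b) -> ~~ connect D (last z b) p ->
  [/\ y != p, D y z & ~~ connect D (last z b) x].
Proof.
move=> eh Dpx pNzb lNp; have ex : h = rcons a y ++ [:: x, z & b] by rewrite cat_rcons.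
have ez : h = rcons (rcons a y) x ++ z :: b by rewrite !cat_rcons.
have xNp := jump_strict (suffix_path ex) pNzb lNp.
have /norP[pNz _] := pNzb.
have cxz : connect D x z by apply: (connect_suffix ex); rewrite !inE eqxx orbT.
have zNx : ~~ connect D z x.
  apply: contra pNz => czx; apply: (arc_shift_head Dls Dpx czx).
  by apply: contra xNp; apply: connect_trans.
have Dyz := bypass eh zNx; split=> //; first by apply: contraNneq pNz => <-.
by apply: contra zNx; apply: connect_trans; apply: (connect_suffix ez) (mem_last _ _).
Qed.

(* The vertex u stands for y as long as y itself has not just become the
   interior vertex p of the greedy path. *)
Lemma kept_path a y s p u : h = a ++ y :: s -> has (D p) s ->
    ~~ connect D (last y s) p -> u = y \/ y = p -> D u (head y s) ->
  path D u (kept D p s).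
Proof.
elim: s a y p u => [//|x s IHs] a y p u eh Dps lNp uy /= Dux.
have ex : h = rcons a y ++ x :: s by rewrite cat_rcons.
case: ifPn => [Dps' | pNs] /=.
  rewrite Dux; apply: (IHs _ _ _ _ ex Dps' lNp (or_introl erefl)).
  by case: (s) Dps' (ex) => [//|z s'] _ /suffix_path/andP[].
have Dpx : D p x by move: Dps; rewrite /= (negPf pNs) orbF.
case: s => [|z s] in IHs eh lNp ex pNs Dps *; first by rewrite /= Dux.
have [ynp Dyz lNx] := jump_next eh Dpx pNs lNp.
have {uy}-> : u = y by case: uy => // /eqP; rewrite (negPf ynp).
have /andP[Dxz _] := suffix_path ex.
(* [x] becomes the next greedy vertex and is left out: the kept path waits at [y] and continues with
   the bypassing arc to [z]. *)
by apply: IHs ex _ lNx (or_intror erefl) Dyz; rewrite /= Dxz.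
Qed.

(* An arc between two different strong components. *)
Definition strict_arc := [rel x y | D x y && ~~ connect D y x].

Lemma hops_path a y s p : h = a ++ y :: s -> has (D p) s ->
    ~~ connect D (last y s) p ->
  path strict_arc p (rcons (hops D p s) (last y s)).
Proof.
elim: s a y p => [//|x s IHs] a y p eh Dps lNp /=.
have ex : h = rcons a y ++ x :: s by rewrite cat_rcons.
case: ifPn => [Dps' | pNs] /=; first exact: IHs ex Dps' lNp.
have Dpx : D p x by move: Dps; rewrite /= (negPf pNs) orbF.
have xNp := jump_strict (suffix_path ex) pNs lNp.
case: s => [|z s] in IHs eh lNp ex pNs Dps *; first by rewrite /= Dpx xNp.
have [_ _ lNx] := jump_next eh Dpx pNs lNp.
have /andP[Dxz _] := suffix_path ex.
by rewrite /= Dpx xNp; apply: IHs ex _ lNx; rewrite /= Dxz.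
Qed.

(** Invariant: the current vertex of a competing path reaches the greedy vertex [p]. Its next vertex
    [u] either reaches [p], or is an out-neighbour of [p] by [arc_shift_tail] and hence lies on [h]
    no later than the greedy choice [v]. Either way [u] reaches [v]. *)
Lemma hops_shortest a y s p x Q : h = a ++ y :: s -> has (D p) s ->
    ~~ connect D (last y s) p -> path D x Q -> connect D x p ->
    connect D (last y s) (last x Q) ->
  size (hops D p s) < size Q.
Proof.
elim: s a y p x Q => [//|v s IHs] a y p x Q eh Dps lNp DQ cxp clQ /=.
have ev : h = rcons a y ++ v :: s by rewrite cat_rcons.
case: ifPn => [Dps' | pNs] /=; first exact: IHs ev Dps' lNp DQ cxp clQ.
have Dpv : D p v by move: Dps; rewrite /= (negPf pNs) orbF.
case: Q => [|u Q] in DQ clQ *; first by case/negP: lNp; apply: connect_trans clQ cxp.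
move: DQ => /= /andP[Dxu DQ].
have cuv : connect D u v.
  case: (boolP (connect D u p)) => [cup|uNp].
    exact: connect_trans cup (connect1 Dpv).
  have Dpu := arc_shift_tail Dls Dxu cxp uNp.
  apply: (connect_prefix ev); have := Th u.
  rewrite ev -cat_rcons mem_cat => /orP[//|us].
  by case/hasP: pNs; exists u.
case: s => [|z s] in IHs eh lNp ev pNs Dps clQ *; first by [].
have [_ _ lNv] := jump_next eh Dpv pNs lNp.
have /andP[Dvz _] := suffix_path ev.
by rewrite /= ltnS; apply: IHs ev _ lNv DQ cuv clQ; rewrite /= Dvz.
Qed.

End HamiltonPath.

(** * Strong components as classes of mutual reachability, and their order *)

Section StrongComponents.
Variables (T : finType) (D : rel T) (C : seq {set T}).
Hypothesis DC : acyclic_ordering D C.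
Implicit Types (x y z : T) (X : {set T}).

Definition component x : {set T} := [set y | connect D x y && connect D y x].

Lemma component_refl x : x \in component x.
Proof. by rewrite inE connect0. Qed.

(** Every vertex on a path between two members reaches [x] and is reached from [x], so the path
    stays inside. *)
Lemma reachable_component x : reachable_within D (component x).
Proof.
apply/forall_inP=> y; rewrite inE => /andP[cxy cyx].
apply/forall_inP=> z; rewrite inE => /andP[cxz czx].
have /connectP[p] := connect_trans cyx cxz.
elim: p y cxy cyx => [|u p IHp] y cxy cyx /=; first by move=> _ ->.
move=> /andP[Dyu Dup] ez.
have cuz : connect D u z by apply/connectP; exists p.
have cxu := connect_trans cxy (connect1 Dyu).
have cux := connect_trans cuz czx.
apply: connect_trans (IHp _ cxu cux Dup ez); apply: connect1.
by rewrite /induced /= !inE cxy cyx cxu cux.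
Qed.

Lemma sub_component X x : reachable_within D X -> x \in X -> X \subset component x.
Proof.
move=> /forall_inP rX xX; apply/subsetP=> y yX.
have sub : subrel (connect (induced D X)) (connect D).
  by apply: connect_sub => u v /and3P[_ _ Duv]; apply: connect1.
by rewrite inE !sub //; [apply: (forall_inP (rX y yX))|apply: (forall_inP (rX x xX))].
Qed.

Definition level x := index (component x) C.

Hypothesis T_gt0 : 0 < #|T|.

Lemma strong_componentE X : strong_component D X -> exists x, X = component x.
Proof.
case/maxsetP=> rX mX; have [X0|[x xX]] := set_0Vmem X; last first.
  by exists x; apply/esym/(mX _ (reachable_component x))/sub_component.
have /card_gt0P[x _] := T_gt0; exists x.
by apply/esym/(mX _ (reachable_component x)); rewrite X0 sub0set.
Qed.

Lemma strong_component_component x : strong_component D (component x).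
Proof.
apply/maxsetP; split=> [|X rX sxX]; first exact: reachable_component.
apply/eqP; rewrite eqEsubset sxX sub_component //.
exact: subsetP sxX _ (component_refl x).
Qed.

Lemma component_in x : component x \in C.
Proof. by have [_ -> _] := DC; apply: strong_component_component. Qed.

Lemma level_lt x : level x < size C.
Proof. by rewrite index_mem component_in. Qed.

Lemma nth_level x : nth set0 C (level x) = component x.
Proof. by rewrite nth_index ?component_in. Qed.

Lemma level_connect x y : connect D x y -> level x <= level y.
Proof.
case/connectP=> p + ->; elim: p x => [//|z p IHp] x /= /andP[Dxz /IHp].
apply: leq_trans; rewrite leqNgt; apply/negP => lt_zx; have [_ _ nD] := DC.
suff : ~~ D x z by rewrite Dxz.
by apply: (nD (level z) (level x)); rewrite ?lt_zx ?level_lt ?nth_level ?component_refl.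
Qed.

Lemma level_nth i : i < size C -> exists x, level x = i.
Proof.
move=> iC; have [uC CE _] := DC.
have [x eX] : exists x, nth set0 C i = component x.
  by apply: strong_componentE; rewrite -CE mem_nth.
by exists x; rewrite /level -eX index_uniq.
Qed.

(** Some vertex has level 0 and [x] reaches it; since levels do not decrease along paths, [x] has
    level 0 too. *)
Lemma head_component x : (forall y, connect D x y) -> head set0 C = component x.
Proof.
move=> cx; have C0 : 0 < size C by apply: leq_ltn_trans (level_lt x).
have [y ly0] := level_nth C0; rewrite -nth0 -nth_level; congr nth.
by apply/esym/eqP; rewrite -leqn0 -ly0 level_connect.
Qed.

Lemma last_component x : (forall y, connect D y x) -> last set0 C = component x.
Proof.
move=> cx; have lx := level_lt x.
have Cp : (size C).-1 < size C by rewrite prednK // (leq_ltn_trans _ lx).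
have [y ly] := level_nth Cp; rewrite -nth_last -nth_level; congr nth.
apply/eqP; rewrite eqn_leq -{1}ly level_connect //=.
by rewrite -ltnS prednK // (leq_ltn_trans _ lx).
Qed.

End StrongComponents.

(** * Arcs of paths and cycles, and the Hamilton oriented cycle *)

Lemma path_arcs_cat (T : finType) (x : T) p1 p2 :
  path_arcs (x :: p1 ++ p2) = path_arcs (x :: p1) ++ path_arcs (last x p1 :: p2).
Proof. by elim: p1 x => [//|y p1 IHp] x; rewrite /= -IHp. Qed.

Lemma cyclic_pairs_cons (T : finType) (x : T) p :
  cyclic_pairs (x :: p) = path_arcs (x :: rcons p x).
Proof.
(* Only the closing copies of [x] are generalized, so that the induction may change the first
   vertex. *)
rewrite /cyclic_pairs rot1_cons; move: {2 4}x => y.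
by elim: p x => [//|z p IHp] x; rewrite /= IHp.
Qed.

Lemma mem_path_arcs_rev (T : finType) (x : T) p a b :
  ((a, b) \in path_arcs (last x p :: rev (belast x p))) = ((b, a) \in path_arcs (x :: p)).
Proof.
elim: p x => [//|y p IHp] x; rewrite [last _ _]/= [belast _ _]/= rev_cons -cats1.
have ly : last (last y p) (rev (belast y p)) = y.
  by case: (p) => [//|z q]; rewrite /= rev_cons last_rcons.
by rewrite path_arcs_cat mem_cat IHp ly /= !inE orbC !xpair_eqE andbC.
Qed.

Lemma path_arcsP (T : finType) (D : rel T) x p a b :
  path D x p -> (a, b) \in path_arcs (x :: p) -> D a b.
Proof.
elim: p x => [//|y p IHp] x /= /andP[Dxy Dyp]; rewrite inE => /predU1P[[-> ->] //|].
exact: IHp.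
Qed.

(** The cycle follows the kept vertices from [x] to [l] and returns against the greedy path.
    Strictness of the hops matters here: a hop whose reverse were also an arc would count as forward
    on the return. *)
Lemma hamilton_walk (T : finType) (D : rel T) (C : seq {set T}) x s :
  2 < #|T| -> locally_semicomplete D -> ~ strong D -> acyclic_ordering D C ->
  k_connected 2 (underlying D) -> path D x s -> uniq (x :: s) ->
  (forall y, y \in x :: s) ->
  let P := x :: rcons (hops D x s) (last x s) in
  let R := x :: walk D x s [::] in
  [/\ shortest_st_path D (head set0 C) (last set0 C) P,
      hamilton_oriented_cycle D R,
      subpath_of_cycle P R
    & backward_arcs D R =i path_arcs P].
Proof.
move=> T3 Dls Dns DC Dcut Ds us Ts P R; set l := last x s in P *.
have T_gt0 : 0 < #|T| by apply: ltn_trans T3.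
have cx y : connect D x y := path_connect Ds (Ts y).
have cl y : connect D y l.
  apply: (connect_prefix (h := x :: s) Ds (a := belast x s) (b := [::])) => //.
    by rewrite cats1 -lastI.
  by rewrite -lastI.
have lNx : ~~ connect D l x.
  apply/negP => clx; apply: Dns => y z.
  exact: connect_trans (cl y) (connect_trans clx (cx z)).
have Dh : sorted D (x :: s) by [].
have eh : x :: s = [::] ++ x :: s by [].
have Dxs : has (D x) s := has_out_arc Dls Ds (connect0 _ _) lNx.
have hP := hops_path Dls Dcut Dh us Ts eh Dxs lNx; rewrite -/l in hP.
have kP : path D x (kept D x s).
  apply: (kept_path Dls Dcut Dh us Ts eh Dxs lNx (or_introl erefl)).
  by case: (s) Ds Dxs => [//|z s'] /= /andP[].
have HC := head_component DC T_gt0 cx; have LC := last_component DC T_gt0 cl.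
have eR : R = x :: kept D x s ++ rev (hops D x s) by rewrite /R walkE.
have pR : perm_eq R (x :: s).
  rewrite eR perm_cons; apply: perm_trans (perm_kept_hops D x s).
  by rewrite perm_cat2l perm_rev.
have lk : last x (kept D x s) = l by rewrite last_kept.
(* Reachability without return is a strict order; it yields both the distinctness of the vertices of
   [P] and the position of its interior. *)
pose lt := [rel y z | connect D y z && ~~ connect D z y].
have lt_trans : transitive lt.
  move=> z y w /andP[cyz zNy] /andP[czw wNz]; rewrite /lt /= (connect_trans cyz) //.
  by apply: contra zNy; apply: connect_trans.
have ltP : path lt x (rcons (hops D x s) l).
  by apply: sub_path hP => y z /andP[/connect1 cyz zNy]; apply/andP.
have eP : l :: rcons (rev (hops D x s)) x
          = last x (rcons (hops D x s) l) :: rev (belast x (rcons (hops D x s) l)).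
  by rewrite last_rcons belast_rcons rev_cons.
split.
- split=> [|[//|y Q] [DQ _ yS lS _]]; last first.
    rewrite /= size_rcons !ltnS.
    apply: (hops_shortest Dls Dcut Dh us Ts eh Dxs lNx DQ).
    + by move: yS; rewrite HC inE => /andP[].
    + by move: lS; rewrite LC inE => /andP[].
  split.
  + by apply: sub_path hP => y z /andP[].
  + apply: (@sorted_uniq _ lt) => // y.
    by rewrite /lt /= connect0.
  + by rewrite HC component_refl.
  + by rewrite last_rcons LC component_refl.
  + move=> z; rewrite last_rcons in_cons mem_rcons in_cons.
    move=> + /negPf zx /negPf zl; rewrite zx zl /= => zh.
    (* By transitivity of [lt], [z] does not reach [x] and is not reached from [l]. *)
    rewrite HC LC !inE negb_or !negb_and; apply/andP; split; apply/orP; [right|left].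
    * have /allP/(_ z) := order_path_min lt_trans ltP.
      by rewrite mem_rcons in_cons zh orbT => /(_ isT)/andP[].
    * move: ltP; rewrite -cats1; case/splitPr: zh => h1 h2.
      rewrite -catA cat_path /= => /and3P[_ _ /(order_path_min lt_trans)/allP/(_ l)].
      by rewrite mem_cat mem_seq1 eqxx orbT => /(_ isT)/andP[].
- split; last by move=> y; rewrite (perm_mem pR).
  split; first by rewrite (perm_size pR) -(card_uniqP us) (eq_card (B := T)).
  rewrite /ucycle (perm_uniq pR) us andbT eR /= rcons_cat cat_path lk.
  rewrite (sub_path _ kP) /=; last by move=> y z Dyz; apply/orP; left.
  move: (rev_path (underlying D) x (rcons (hops D x s) l)).
  rewrite last_rcons belast_rcons rev_cons => ->.
  by apply: sub_path hP => y z /andP[Dyz _]; apply/orP; right.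
- have [k ek] : exists k, kept D x s = rcons k l.
    case/lastP: (kept D x s) lk => [/= xl|k z]; last by rewrite last_rcons => <-; exists k.
    by case/negP: lNx; rewrite -xl.
  (* The reversed cycle ends in [x]; rotating this [x] to the front puts the hops and then [l] right
     behind it, which is [P]. *)
  exists (size (hops D x s ++ l :: rev k)); right.
  have -> : rev R = (hops D x s ++ l :: rev k) ++ [:: x].
    by rewrite eR ek rev_cons rev_cat revK rev_rcons cats1.
  by rewrite rot_size_cat /P /= eqxx -cat_rcons prefix_prefix.
- move=> [a b]; rewrite -mem_path_arcs_rev -eP /backward_arcs eR cyclic_pairs_cons.
  have swap_inj : injective (fun u : T * T => (u.2, u.1)) by move=> [? ?] [? ?] [-> ->].
  rewrite (mem_map swap_inj _ (b, a)) mem_filter /= rcons_cat path_arcs_cat mem_cat lk.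
  case: (boolP ((b, a) \in path_arcs (l :: _))) => [|_].
    rewrite eP mem_path_arcs_rev orbT andbT => /(path_arcsP hP)/andP[_].
    by apply: contra => /connect1.
  by rewrite orbF; apply/negP => /andP[/negP bNa /(path_arcsP kP)].
Qed.

(** * The algorithm as a program on trees *)

(* In the bodies below, [ECall f] refers to the position f in [prog]. *)
Definition look_body :=
  EIf (EVar 0) (ECall 1 [:: ETl (EVar 0); ETl (EVar 1)]) (EHd (EVar 1)).

(** A vertex is a pair of its row number and its row: the row of the first is read at the number of
    the second. *)
Definition arc_body := ECall 1 [:: EHd (EVar 1); ETl (EVar 0)].

Definition has_out_body :=
  EIf (EVar 1)
    (EIf (ECall 2 [:: EVar 0; EHd (EVar 1)]) (ECons ENil ENil)
       (ECall 3 [:: EVar 0; ETl (EVar 1)]))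
    ENil.

Definition has_adj_body :=
  EIf (EVar 1)
    (EIf (ECall 2 [:: EVar 0; EHd (EVar 1)]) (ECons ENil ENil)
       (EIf (ECall 2 [:: EHd (EVar 1); EVar 0]) (ECons ENil ENil)
          (ECall 4 [:: EVar 0; ETl (EVar 1)])))
    ENil.

Definition insert_body :=
  EIf (EVar 1)
    (EIf (ECall 2 [:: EVar 0; EHd (EVar 1)]) (ECons (EVar 0) (EVar 1))
       (ECons (EHd (EVar 1)) (ECall 5 [:: EVar 0; ETl (EVar 1)])))
    (ECons (EVar 0) ENil).

Definition absorb_body :=
  EIf (EVar 0)
    (EIf (ECall 4 [:: EHd (EVar 0); EVar 1])
       (ECall 6 [:: ETl (EVar 0); ECall 5 [:: EHd (EVar 0); EVar 1]])
       (ELet (ECall 6 [:: ETl (EVar 0); EVar 1])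
          (ECons (ECons (EHd (EVar 1)) (EHd (EVar 0))) (ETl (EVar 0)))))
    (ECons ENil (EVar 1)).

Definition absorb_iter_body :=
  EIf (EVar 0)
    (ELet (ECall 6 [:: EVar 1; EVar 2])
       (ECall 7 [:: ETl (EVar 1); EHd (EVar 0); ETl (EVar 0)]))
    (EVar 2).

Definition walk_body :=
  EIf (EVar 1)
    (EIf (ECall 3 [:: EVar 0; ETl (EVar 1)])
       (ECons (EHd (EVar 1)) (ECall 8 [:: EVar 0; ETl (EVar 1); EVar 2]))
       (EIf (ETl (EVar 1))
          (ECall 8 [:: EHd (EVar 1); ETl (EVar 1); ECons (EHd (EVar 1)) (EVar 2)])
          (ECons (EHd (EVar 1)) (EVar 2))))
    (EVar 2).

Definition strip_body :=
  EIf (EVar 0) (ECons (EHd (EHd (EVar 0))) (ECall 9 [:: ETl (EVar 0)])) ENil.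

(** The second argument is a unary counter of the rows already read. *)
Definition build_body :=
  EIf (EVar 0)
    (ECons (ECons (EVar 1) (EHd (EVar 0)))
       (ECall 10 [:: ETl (EVar 0); ECons ENil (EVar 1)]))
    ENil.

(** The first labelled vertex is the initial path; the others serve both as fuel and as the vertices
    to insert. *)
Definition main_body :=
  ELet (ECall 10 [:: EVar 0; ENil])
    (ELet (ECall 7 [:: ETl (EVar 0); ETl (EVar 0); ECons (EHd (EVar 0)) ENil])
       (ECall 9 [:: ECons (EHd (EVar 0))
                      (ECall 8 [:: EHd (EVar 0); ETl (EVar 0); ENil])])).

Definition prog : program :=
  [:: main_body; look_body; arc_body; has_out_body; has_adj_body; insert_body;
      absorb_body; absorb_iter_body; walk_body; strip_body; build_body].

(** * Compositional upper bounds on the number of evaluation steps *)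

Definition cost env e v t := exists2 n, n <= t & eval prog env e v n.
Definition costs env es vs t := exists2 n, n <= t & evals prog env es vs n.

Lemma cost_le env e v t t' : cost env e v t -> t <= t' -> cost env e v t'.
Proof. by case=> n le_n ev le_t; exists n => //; apply: leq_trans le_t. Qed.

Lemma cost_eq env e v v' t : cost env e v t -> v = v' -> cost env e v' t.
Proof. by move=> ? <-. Qed.

Lemma cost_var env i : cost env (EVar i) (nth Leaf env i) 1.
Proof. by exists 1 => //; apply: EvVar. Qed.

Lemma cost_nil env : cost env ENil Leaf 1.
Proof. by exists 1 => //; apply: EvNil. Qed.

Lemma cost_cons env e1 e2 v1 v2 t1 t2 : cost env e1 v1 t1 -> cost env e2 v2 t2 ->
  cost env (ECons e1 e2) (Node v1 v2) (t1 + t2).+1.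
Proof.
by case=> n ln en [m lm em]; exists (n + m).+1; [rewrite ltnS leq_add|apply: EvCons].
Qed.

Lemma cost_hd env e v t : cost env e v t -> cost env (EHd e) (hd v) t.+1.
Proof. by case=> n ln en; exists n.+1 => //; apply: EvHd. Qed.

Lemma cost_tl env e v t : cost env e v t -> cost env (ETl e) (tl v) t.+1.
Proof. by case=> n ln en; exists n.+1 => //; apply: EvTl. Qed.

Lemma cost_if env e e1 e2 c v t1 t2 : cost env e c t1 ->
  cost env (if c is Node _ _ then e1 else e2) v t2 ->
  cost env (EIf e e1 e2) v (t1 + t2).+1.
Proof.
case=> n ln en [m lm em]; exists (n + m).+1; first by rewrite ltnS leq_add.
by case: c en em => [|a b] en em; [apply: EvIfNil en em|apply: EvIfCons en em].
Qed.

Lemma cost_let env e1 e2 v1 v t1 t2 : cost env e1 v1 t1 ->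
  cost (v1 :: env) e2 v t2 -> cost env (ELet e1 e2) v (t1 + t2).+1.
Proof.
case=> n ln en [m lm em]; exists (n + m).+1; first by rewrite ltnS leq_add.
exact: EvLet en em.
Qed.

Lemma cost_call env f es body vs v t1 t2 : onth prog f = Some body ->
  costs env es vs t1 -> cost vs body v t2 -> cost env (ECall f es) v (t1 + t2).+1.
Proof.
move=> fb [n ln en] [m lm em]; exists (n + m).+1; first by rewrite ltnS leq_add.
exact: EvCall fb en em.
Qed.

Lemma costs_nil env : costs env [::] [::] 0.
Proof. by exists 0 => //; apply: EvsNil. Qed.

Lemma costs_cons env e es v vs t1 t2 : cost env e v t1 -> costs env es vs t2 ->
  costs env (e :: es) (v :: vs) (t1 + t2).
Proof.
by case=> n ln en [m lm em]; exists (n + m); [rewrite leq_add|apply: EvsCons].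
Qed.

Ltac cost_step :=
  first
    [ apply cost_var | apply cost_nil | eapply cost_cons | eapply cost_hd
    | eapply cost_tl | apply costs_nil | eapply costs_cons ].

Ltac cost_pure := solve [eapply cost_eq; [repeat cost_step | reflexivity]].

(* Leaves the evaluation of the called body. *)
Ltac cost_call := eapply cost_call; [reflexivity | solve [repeat cost_step] |].

Ltac cost_branch := eapply cost_if; [solve [repeat cost_step] |].

Lemma cost_look i l :
  cost [:: enc_nat i; enc_seq l] look_body (nth Leaf l i) (9 * i + 9).
Proof.
elim: i l => [|i IHi] l.
  (* On the empty list [hd] yields [Leaf], which agrees with the default of [nth]. *)
  have -> : nth Leaf l 0 = hd (enc_seq l) by case: l.
  by eapply cost_le; first (cost_branch; cost_pure).
have := IHi (behead l); rewrite nth_behead.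
have <- : tl (enc_seq l) = enc_seq (behead l) by case: l.
move=> IH; eapply cost_le; first by cost_branch; cost_call; exact: IH.
by lia.
Qed.

(** * Correctness and cost of each function of the program *)

Section Encoding.
Variables (T : finType) (D : rel T).
Implicit Types (x y w p : T) (s rem fuel acc : seq T).

(* A vertex carries its row of the matrix, so that no function needs the whole
   matrix to test an arc. *)
Definition enc_vertex x : tree :=
  Node (enc_nat (index x (enum T))) (enc_seq [seq enc_bool (D x y) | y <- enum T]).

Definition enc_labels s : tree := enc_seq (map enc_vertex s).

(** Bound for one arc test; it is linear because row numbers are unary. *)
Let A := 9 * #|T| + 17.

Lemma cost_arc x y : cost [:: enc_vertex x; enc_vertex y] arc_body (enc_bool (D x y)) A.
Proof.
have iy : index y (enum T) < #|T| by rewrite cardE index_mem mem_enum.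
have <- : nth Leaf [seq enc_bool (D x z) | z <- enum T] (index y (enum T))
          = enc_bool (D x y).
  by rewrite (nth_map y) ?nth_index ?mem_enum // index_mem mem_enum.
eapply cost_le; first by cost_call; exact: cost_look.
by rewrite /A; lia.
Qed.

Lemma cost_has_out p s :
  cost [:: enc_vertex p; enc_labels s] has_out_body (enc_bool (has (D p) s))
    ((A + 20) * (size s).+1).
Proof.
elim: s => [|x s IHs].
  by eapply cost_le; [cost_branch; cost_pure | lia].
have Dpx := cost_arc p x; rewrite [has _ _]/=; case: (D p x) Dpx => Dpx.
  eapply cost_le.
    cost_branch; eapply cost_if; first by cost_call; exact: Dpx.
    cost_pure.
  by rewrite /=; lia.
eapply cost_le.
  cost_branch; eapply cost_if; first by cost_call; exact: Dpx.
  by cost_call; exact: IHs.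
by rewrite /=; lia.
Qed.

Lemma cost_has_adj w s :
  cost [:: enc_vertex w; enc_labels s] has_adj_body
    (enc_bool (has (underlying D w) s)) ((2 * A + 40) * (size s).+1).
Proof.
elim: s => [|x s IHs].
  by eapply cost_le; [cost_branch; cost_pure | lia].
have Dwx := cost_arc w x; have Dxw := cost_arc x w.
have ->: has (underlying D w) (x :: s) = [|| D w x, D x w | has (underlying D w) s].
  by rewrite orbA.
case: (D w x) Dwx => Dwx.
  eapply cost_le.
    cost_branch; eapply cost_if; first by cost_call; exact: Dwx.
    cost_pure.
  by rewrite /=; lia.
case: (D x w) Dxw => Dxw.
  eapply cost_le.
    cost_branch; eapply cost_if; first by cost_call; exact: Dwx.
    eapply cost_if; first by cost_call; exact: Dxw.
    cost_pure.
  by rewrite /=; lia.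
eapply cost_le.
  cost_branch; eapply cost_if; first by cost_call; exact: Dwx.
  eapply cost_if; first by cost_call; exact: Dxw.
  by cost_call; exact: IHs.
by rewrite /=; lia.
Qed.

Lemma cost_insert w s :
  cost [:: enc_vertex w; enc_labels s] insert_body (enc_labels (insert D w s))
    ((A + 30) * (size s).+1).
Proof.
elim: s => [|x s IHs].
  by eapply cost_le; [cost_branch; cost_pure | lia].
have Dwx := cost_arc w x; rewrite [insert _ _ _]/=; case: (D w x) Dwx => Dwx.
  eapply cost_le.
    cost_branch; eapply cost_if; first by cost_call; exact: Dwx.
    cost_pure.
  by rewrite /=; lia.
eapply cost_le.
  cost_branch; eapply cost_if; first by cost_call; exact: Dwx.
  eapply cost_cons; first cost_pure.
  by cost_call; exact: IHs.
by rewrite /=; lia.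
Qed.

Let N := #|T|.
(** Bound for one vertex in a pass: per path vertex, [2 * A + 40] for the adjacency test and
    [A + 30] for an insertion, plus overhead. *)
Let K := (3 * A + 120) * N.+1.

Lemma cost_absorb rem s : size rem + size s <= N ->
  cost [:: enc_labels rem; enc_labels s] absorb_body
    (Node (enc_labels (absorb D rem s).1) (enc_labels (absorb D rem s).2))
    (K * (size rem).+1).
Proof.
elim: rem s => [|w rem IHrem] s le_rs.
  by eapply cost_le; [cost_branch; cost_pure | rewrite /K /=; lia].
have le_sN : (size s).+1 <= N.+1 by rewrite ltnS (leq_trans _ le_rs) ?leq_addl.
have adj := cost_le (cost_has_adj w s) (leq_mul (leqnn _) le_sN).
have ins := cost_le (cost_insert w s) (leq_mul (leqnn _) le_sN).
rewrite [absorb _ _ _]/=; case: (has _ s) adj => adj.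
  have {}IHrem := IHrem (insert D w s).
  rewrite size_insert addnS in IHrem; eapply cost_le.
    cost_branch; eapply cost_if; first by cost_call; exact: adj.
    eapply cost_call; [reflexivity | | ]; last exact: IHrem.
    apply: (costs_cons (v := tl (enc_labels (w :: rem)))); first cost_pure.
    by eapply costs_cons; [cost_call; exact: ins | cost_step].
  by rewrite /K /=; lia.
eapply cost_le.
  cost_branch; eapply cost_if; first by cost_call; exact: adj.
  eapply cost_let; first by cost_call; exact: (IHrem s (ltnW le_rs)).
  cost_pure.
by rewrite /K /=; lia.
Qed.

Lemma cost_absorb_iter fuel rem s : size rem + size s <= N ->
  cost [:: enc_labels fuel; enc_labels rem; enc_labels s] absorb_iter_body
    (enc_labels (absorb_iter D fuel rem s)) ((K * N.+1 + 30) * (size fuel).+1).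
Proof.
elim: fuel rem s => [|f fuel IHf] rem s le_rs.
  by eapply cost_le; [cost_branch; cost_pure | rewrite /=; lia].
have le_rN : (size rem).+1 <= N.+1 by rewrite ltnS (leq_trans _ le_rs) ?leq_addr.
have absr := cost_le (cost_absorb le_rs) (leq_mul (leqnn _) le_rN).
have {}IHf := IHf (absorb D rem s).1 (absorb D rem s).2.
rewrite size_absorb in IHf; eapply cost_le.
  cost_branch; eapply cost_let; first by cost_call; exact: absr.
  by cost_call; exact: IHf.
by rewrite /=; lia.
Qed.

Lemma cost_walk p s acc : size s <= N ->
  cost [:: enc_vertex p; enc_labels s; enc_labels acc] walk_body
    (enc_labels (walk D p s acc)) (((A + 20) * N.+1 + 50) * (size s).+1).
Proof.
elim: s p acc => [|x s IHs] p acc le_sN.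
  by eapply cost_le; [cost_branch; cost_pure | rewrite /=; lia].
have Dps := cost_le (cost_has_out p s) (leq_mul (leqnn _) (ltnW le_sN : _ < N.+1)).
have {}IHs p' acc' := IHs p' acc' (ltnW le_sN).
rewrite [walk _ _ _ _]/=; case: (has (D p) s) Dps => Dps.
  eapply cost_le.
    cost_branch; eapply cost_if; first by cost_call; exact: Dps.
    apply: (cost_cons (v1 := hd (enc_labels (x :: s)))); first cost_pure.
    by cost_call; exact: IHs.
  by rewrite /=; lia.
case: s => [|y s] in le_sN Dps IHs *.
  eapply cost_le.
    cost_branch; eapply cost_if; first by cost_call; exact: Dps.
    by cost_branch; cost_pure.
  by rewrite /=; lia.
eapply cost_le.
  cost_branch; eapply cost_if; first by cost_call; exact: Dps.
  by cost_branch; cost_call; exact: (IHs x (x :: acc)).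
by rewrite /=; lia.
Qed.

Lemma cost_strip s :
  cost [:: enc_labels s] strip_body (enc_vertices s) (20 * (size s).+1).
Proof.
elim: s => [|x s IHs].
  by eapply cost_le; [cost_branch; cost_pure | rewrite /=; lia].
eapply cost_le.
  cost_branch; apply: (cost_cons (v1 := hd (enc_vertex x))); first cost_pure.
  by cost_call; exact: IHs.
by rewrite /=; lia.
Qed.

(** The induction carries the prefix [a] already read; as [enum T] has no repetition, [size a] is
    the index of the next vertex. *)
Lemma cost_build a b : enum T = a ++ b ->
  cost [:: enc_seq [seq enc_seq [seq enc_bool (D x y) | y <- enum T] | x <- b];
           enc_nat (size a)] build_body (enc_labels b) (20 * (size b).+1).
Proof.
elim: b a => [|x b IHb] a eT.
  by eapply cost_le; [cost_branch; cost_pure | rewrite /=; lia].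
have xa : index x (enum T) = size a.
  have := enum_uniq T; rewrite eT cat_uniq /= negb_or => /and3P[_ /andP[xNa _] _].
  by rewrite index_cat (negPf xNa) /= eqxx addn0.
have := IHb (rcons a x); rewrite cat_rcons size_rcons => /(_ eT) {}IHb.
eapply cost_le.
  cost_branch; apply: (cost_cons (v1 := enc_vertex x)).
    by rewrite /enc_vertex xa; cost_pure.
  by cost_call; exact: IHb.
by rewrite /=; lia.
Qed.

(** The four summands account for labelling the rows, building the Hamilton path, the walk, and the
    output. *)
Lemma cost_main x s : enum T = x :: s ->
  let h := absorb_iter D s s [:: x] in
  size h = N ->
  cost [:: enc_digraph D] main_body
    (enc_vertices (head x h :: walk D (head x h) (behead h) [::]))
    (((20 * N.+1 + 10)
     + (((K * N.+1 + 30) * N.+1 + 20)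
     + ((((A + 20) * N.+1 + 50) * N.+1 + 20) + (20 * N.+1 + 60))))).
Proof.
move=> eT h hN; have sN : (size s).+1 = N by rewrite /N cardE eT.
have build : cost [:: enc_digraph D; Leaf] build_body (enc_labels (enum T)) (20 * N.+1).
  by rewrite /N cardE; apply: (cost_build (a := [::])).
have iter : size s + size [:: x] <= N by rewrite addn1 sN.
have {}iter := cost_absorb_iter s iter; rewrite sN -/h in iter.
case: h hN iter => [|y h] /= hN iter; first by rewrite -sN in hN.
have le_hN : size h <= N by rewrite -hN.
have wk := cost_walk y [::] le_hN; rewrite hN in wk.
have strip := cost_strip (y :: walk D y h [::]).
rewrite /= size_walk hN in strip; rewrite eT in build.
eapply cost_le.
  eapply cost_let; first by cost_call; exact: build.
  eapply cost_let; first by cost_call; exact: iter.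
  eapply cost_call; [reflexivity | | exact: strip].
  eapply costs_cons; last by cost_step.
  apply: (cost_cons (v1 := hd (enc_labels (y :: h)))); first cost_pure.
  by cost_call; exact: wk.
by lia.
Qed.

End Encoding.

(** * A quartic time bound and the existence of the cycle *)

Lemma polynomial_bound N m A K : 0 < N -> N <= m ->
  A = 9 * N + 17 -> K = (3 * A + 120) * N.+1 ->
  (1 + 0
   + ((20 * N.+1 + 10)
     + (((K * N.+1 + 30) * N.+1 + 20)
     + ((((A + 20) * N.+1 + 50) * N.+1 + 20) + (20 * N.+1 + 60))))).+1
  <= 5000 * m ^ 4 + 5000.
Proof.
(* [K] is quadratic in [N], so the dominant term [K * N.+1 * N.+1] has degree 4; 5000 leaves ample
   room for the lower terms. *)
move=> N0 Nm -> ->; apply: (@leq_trans (5000 * N ^ 4 + 5000)); last first.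
  by rewrite leq_add2r leq_mul2l leq_exp2r ?Nm ?orbT.
(* Comparing consecutive powers makes the inequality linear in the monomials. *)
have N2 : N <= N * N by rewrite leq_pmulr.
have N3 : N * N <= N * N * N by rewrite leq_pmulr.
have N4 : N * N * N <= N * N * N * N by rewrite leq_pmulr.
by rewrite !expnSr expn0 mul1n; lia.
Qed.

Theorem theorem3p4 :
  (forall (T : finType) (D : rel T) (C : seq {set T}),
     irreflexive D -> 3 <= #|T| ->
     connected (underlying D) -> locally_semicomplete D -> ~ strong D ->
     acyclic_ordering D C ->
     k_connected 2 (underlying D) ->
     exists P R : seq T,
       [/\ shortest_st_path D (head set0 C) (last set0 C) P,
           hamilton_oriented_cycle D R,
           subpath_of_cycle P R
         & backward_arcs D R =i path_arcs P])
  /\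
  (exists (prog : program) (c k : nat),
   forall (T : finType) (D : rel T) (C : seq {set T}),
     irreflexive D -> 3 <= #|T| ->
     connected (underlying D) -> locally_semicomplete D -> ~ strong D ->
     acyclic_ordering D C ->
     k_connected 2 (underlying D) ->
     exists P R : seq T,
       [/\ shortest_st_path D (head set0 C) (last set0 C) P,
           hamilton_oriented_cycle D R,
           subpath_of_cycle P R,
           backward_arcs D R =i path_arcs P
         & computes_within prog (enc_digraph D) (enc_vertices R)
             (c * digraph_size D ^ k + c)]).
Proof.
(* The algorithmic half already supplies [P] and [R] for the existence half. *)
set part2 := (X in _ /\ X); suff H : part2.
  split=> // T D C irrD T3 Dc Dls Dns DC Dcut.
  case: H => pr [c [k H]]; have [P [R [? ? ? ? _]]] := H T D C irrD T3 Dc Dls Dns DC Dcut.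
  by exists P, R.
exists prog, 5000, 4 => T D C _ T3 Dc Dls Dns DC Dcut.
case eT: (enum T) => [|x s]; first by move: T3; rewrite cardE eT.
have pT : perm_eq (s ++ [:: x]) (enum T) by rewrite eT cats1 perm_rcons.
have [|||||Dh ph] := @absorb_iter_spec T D Dls s s [:: x] Dc => //.
- by rewrite (perm_uniq pT) enum_uniq.
- by move=> y; rewrite (perm_mem pT) mem_enum.
have {pT}ph := perm_trans ph pT.
have hN : size (absorb_iter D s s [:: x]) = #|T| by rewrite (perm_size ph) cardE.
have := cost_main eT hN.
case: (absorb_iter _ _ _ _) Dh ph hN => [|y h] Dh ph hN; first by rewrite -hN in T3.
move=> /= main.
have uh : uniq (y :: h) by rewrite (perm_uniq ph) enum_uniq.
have Th z : z \in y :: h by rewrite (perm_mem ph) mem_enum.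
have [sP hR sub bw] := hamilton_walk T3 Dls Dns DC Dcut Dh uh Th.
exists (y :: rcons (hops D y h) (last y h)), (y :: walk D y h [::]); split=> //.
eapply cost_le.
  eapply cost_call; [reflexivity | | exact: main].
  by eapply costs_cons; [exact: cost_var | exact: costs_nil].
by apply: polynomial_bound erefl erefl; rewrite ?leq_addr // (ltn_trans _ T3).
Qed.
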